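(* For all integers $k\ge4$ and $r\ge0$ one has $B_{k,2,r}\ge0$. Equivalently, for every $k\ge4$ the polynomial $A_{k,2}(d)$ has nonnegative coefficients in the binomial basis $\binom dr$, $r\ge0$.
   Context: For integers $k,d\ge0$ let $c_k(2,d)\in\mathbb{Z}[x_1,x_2]$ be the homogeneous degree-$k$ part of $\prod_{i=0}^d(1+ix_1+(d-i)x_2)$. Expand it in two-variable Schur polynomials: $$c_k(2,d)=\sum_{0\le j\le\lfloor k/2\rfloor}A_{k,j}(d)\,s_{(k-j,j)}(x_1,x_2).$$ For fixed $k,j$ with $0\le j\le\lfloor k/2\rfloor$, $A_{k,j}(d)$ is a polynomial function of $d$, and the numbers $B_{k,j,r}$ $(r\ge0)$ are its coefficients in the binomial basis: $A_{k,j}(d)=\sum_{r\ge0}B_{k,j,r}\binom dr$. *)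

(* Defs.v *)
From HB Require Import structures.
From mathcomp Require Import all_boot all_order all_algebra.
From mathcomp Require Import perm mpoly ring zify.

Set Implicit Arguments.
Unset Strict Implicit.
Unset Printing Implicit Defensive.

Import Order.TTheory GRing.Theory Num.Theory.
Local Open Scope ring_scope.

Definition x1 : {mpoly int[2]} := 'X_ord0.
Definition x2 : {mpoly int[2]} := 'X_ord_max.

(* The subtraction [d - i] is on [nat]; it never truncates, since [i <= d]. *)
Definition chern_total (d : nat) : {mpoly int[2]} :=
  \prod_(i < d.+1) (1 + x1 *+ i + x2 *+ (d - i)).

Definition chern2 (k d : nat) : {mpoly int[2]} :=
  pihomog mdeg k (chern_total d).

(* The two-variable Schur polynomial s_(a,b), for [b <= a], as the sum over
   semistandard tableaux of shape (a,b) with entries in {1,2}: the first [b]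
   columns are forced to be (1 above 2), and [i] counts the entries 2 among the
   last [a - b] boxes of the first row.  See [schur2_bialternant]. *)
Definition schur2 (a b : nat) : {mpoly int[2]} :=
  \sum_(i < (a - b).+1) x1 ^+ (a - i) * x2 ^+ (b + i).

(* [a j] is the coefficient of s_(k-j,j) in c_k(2,d), for [j <= k./2]; the
   other values of [a] are irrelevant.  Such an [a] always exists and is unique:
   see [schur_expansion_exists] and [schur_expansion_unique]. *)
Definition schur_expansion (k d : nat) (a : nat -> int) : Prop :=
  chern2 k d = \sum_(j < (k./2).+1) a j *: schur2 (k - j) j.

(* [f] is a polynomial function, with coefficients [b r] in the basis
   'C(d, r) of the polynomials in d.  For a family [f] of Schur coefficients such
   a [b] exists and is unique: see [binomial_expansion_exists] and
   [binomial_expansion_unique]. *)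
Definition binomial_expansion (f : nat -> int) (b : nat -> rat) : Prop :=
  exists N : nat, (forall r, (N <= r)%N -> b r = 0) /\
    forall d, (f d)%:~R = \sum_(r < N) b r * ('C(d, r))%:R.

Definition mon (a b : nat) : 'X_{1..2} := (U_(ord0) *+ a + U_(ord_max) *+ b)%MM.

Lemma mon0 a b : mon a b ord0 = a.
Proof. by rewrite /mon mnmDE !mulmnE !mnm1E /= mul1n mul0n addn0. Qed.

Lemma mon1 a b : mon a b ord_max = b.
Proof. by rewrite /mon mnmDE !mulmnE !mnm1E /= mul1n mul0n. Qed.

Lemma monE (m : 'X_{1..2}) : m = mon (m ord0) (m ord_max).
Proof.
apply/mnmP => i; case: (unliftP ord_max i) => [j ->|->]; last by rewrite mon1.
suff -> : lift ord_max j = ord0 :> 'I_2 by rewrite mon0.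
by apply/val_inj; case: j => [[]].
Qed.

Lemma mon_eq a b a' b' : (mon a b == mon a' b') = (a == a') && (b == b').
Proof.
apply/eqP/andP => [/mnmP e|[/eqP-> /eqP->] //].
by have := e ord0; have := e ord_max; rewrite !mon0 !mon1 => -> ->.
Qed.

Lemma mdeg_mon a b : mdeg (mon a b) = (a + b)%N.
Proof. by rewrite mdegD !mdegMn !mdeg1 !mul1n. Qed.

Lemma x12E a b : x1 ^+ a * x2 ^+ b = 'X_[mon a b].
Proof. by rewrite /x1 /x2 !mpolyXn -mpolyXD. Qed.

Lemma schur2_bialternant a b : (b <= a)%N ->
  schur2 a b * (x1 - x2) = x1 ^+ a.+1 * x2 ^+ b - x1 ^+ b * x2 ^+ a.+1.
Proof.
move=> ba; rewrite /schur2 big_distrl /=.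
pose F i := - (x1 ^+ (a.+1 - i) * x2 ^+ (b + i)).
rewrite (eq_bigr (fun i : 'I_(a - b).+1 => F i.+1 - F i)); last first.
  move=> i _; have ia : (i <= a)%N by case: i => /= i; lia.
  by rewrite /F subSS subSn // addnS !exprS; ring.
rewrite -(big_mkord predT (fun i => F i.+1 - F i)) telescope_sumr // /F.
rewrite subn0 addn0 opprK addrC; congr (_ - _ * _ ^+ _); last by lia.
by congr (_ ^+ _); lia.
Qed.

Lemma mcoeff_schur2 k j a b : (j <= k./2)%N -> (a + b)%N = k ->
  (schur2 (k - j) j)@_(mon a b) = ((j <= a) && (j <= b))%N%:R.
Proof.
move=> jk abk; rewrite /schur2 raddf_sum /=.
under eq_bigr => i _ do rewrite x12E mcoeffX mon_eq.
case: (boolP ((j <= a) && (j <= b))%N) => [/andP[ja jb]|nj].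
  have lt : (b - j < (k - j - j).+1)%N by lia.
  rewrite (bigD1 (Ordinal lt)) //= big1 ?addr0.
    by rewrite (_ : (_ && _) = true) //; lia.
  move=> i /eqP ne; rewrite (_ : (_ && _) = false) //.
  apply/negP => /andP[/eqP e1 /eqP e2]; apply: ne; apply/val_inj => /=; lia.
rewrite big1 // => i _; rewrite (_ : (_ && _) = false) //.
by case: i => /= i ilt; lia.
Qed.

Lemma mcoeff_pihomog k (p : {mpoly int[2]}) m :
  (pihomog mdeg k p)@_m = if mdeg m == k then p@_m else 0.
Proof.
rewrite pihomogE raddf_sum /=.
under eq_bigr => m' _ do rewrite mcoeffZ mcoeffX.
case: ifP => [/eqP mk|mk]; last first.
  rewrite big1 // => m' m'k; case: eqP => [e|_]; last by rewrite mulr0.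
  by rewrite -e m'k in mk.
case: (boolP (m \in msupp p)) => [mp|mp].
  rewrite big_mkcond (bigD1_seq m) ?msupp_uniq //= mk !eqxx mulr1.
  by rewrite big1 ?addr0 // => m' /negbTE->; rewrite mulr0 if_same.
rewrite (memN_msupp_eq0 mp) big1_seq // => m' /andP[_ m'p].
case: eqP => [e|_]; last by rewrite mulr0.
by rewrite -e m'p in mp.
Qed.

Lemma msym_x (s : 'S_2) i : msym s ('X_i : {mpoly int[2]}) = 'X_(s i).
Proof.
rewrite msymX; congr 'X_[_]; apply/mnmP => j; rewrite !mnmE.
by congr nat_of_bool; apply/eqP/eqP => [->|<-]; rewrite ?permKV ?permK.
Qed.

Lemma chern_total_sym d a b :
  (chern_total d)@_(mon a b) = (chern_total d)@_(mon b a).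
Proof.
pose s : 'S_2 := tperm ord0 ord_max.
have symE : msym s (chern_total d) = chern_total d.
  rewrite /chern_total rmorph_prod (reindex_inj rev_ord_inj) /=.
  apply: eq_bigr => i _; have id : (i <= d)%N by case: i.
  rewrite !rmorphD rmorph1 !rmorphMn /= /x1 /x2 !msym_x tpermL tpermR.
  by rewrite subSS subKn // addrAC.
rewrite -[in LHS]symE mcoeff_sym; congr (_@_ _); apply/mnmP => i; rewrite mnmE.
case: (unliftP ord_max i) => [j ->|->]; last by rewrite tpermR mon0 mon1.
have -> : lift ord_max j = ord0 :> 'I_2 by apply/val_inj; case: j => [[]].
by rewrite tpermL mon0 mon1.
Qed.

Lemma schur_expansionP k d a : schur_expansion k d a <->
  forall i, (i <= k./2)%N ->
    \sum_(j < i.+1) a j = (chern_total d)@_(mon (k - i) i).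
Proof.
have coefS u v : (u + v)%N = k ->
    (\sum_(j < (k./2).+1) a j *: schur2 (k - j) j)@_(mon u v)
      = \sum_(j < (minn u v).+1) a j.
  move=> uv; rewrite raddf_sum /=.
  have le : ((minn u v).+1 <= (k./2).+1)%N by lia.
  rewrite [RHS](big_ord_widen _ a le) [RHS]big_mkcond /=; apply: eq_bigr => j _.
  rewrite mcoeffZ mcoeff_schur2 //; last by case: j => /= j; lia.
  by rewrite ltnS leq_min; case: ifP => _; rewrite ?mulr1 ?mulr0.
split=> [e i ik|e].
  have := congr1 (mcoeff (mon (k - i) i)) e.
  rewrite /chern2 mcoeff_pihomog mdeg_mon coefS; last by lia.
  have -> : (k - i + i == k)%N by lia.
  by have -> : minn (k - i) i = i by lia.
apply/mpolyP => m; rewrite [m]monE; move: (m ord0) (m ord_max) => u v.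
rewrite /chern2 mcoeff_pihomog mdeg_mon.
case: eqP => [uv|uv]; last first.
  rewrite raddf_sum big1 //= => j _; rewrite mcoeffZ /schur2 raddf_sum /=.
  rewrite big1 ?mulr0 // => i _; rewrite x12E mcoeffX mon_eq.
  rewrite (_ : (_ && _) = false) //.
  by have := ltn_ord i; have := ltn_ord j; lia.
rewrite coefS // e; last by lia.
have [vu|uv'] := leqP v u.
  by congr (_@_ (mon _ _)); lia.
by rewrite chern_total_sym; congr (_@_ (mon _ _)); lia.
Qed.

Lemma schur_expansion_exists k d : exists a, schur_expansion k d a.
Proof.
pose f i : int := (chern_total d)@_(mon (k - i) i).
exists (fun j => if j is j'.+1 then f j - f j' else f 0%N).
apply/schur_expansionP => i _; elim: i => [|i IH]; first by rewrite big_ord1.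
by rewrite big_ord_recr /= IH addrC subrK.
Qed.

Lemma schur_expansion_unique k d a a' :
  schur_expansion k d a -> schur_expansion k d a' ->
  forall j, (j <= k./2)%N -> a j = a' j.
Proof.
move=> /schur_expansionP e /schur_expansionP e' j jk.
have := e j jk; rewrite -(e' j jk) !big_ord_recr /=.
case: j jk => [|j] jk; first by rewrite !big_ord0 !add0r.
by rewrite (e j) ?(e' j) ?(ltnW jk) // => /addrI.
Qed.

Lemma binomial_expansion_unique f b b' :
  binomial_expansion f b -> binomial_expansion f b' -> b =1 b'.
Proof.
have key c : binomial_expansion f c -> forall d,
    (f d)%:~R = \sum_(r < d) c r * ('C(d, r))%:R + c d :> rat.
  case=> N [c0 fE] d; rewrite fE.
  pose M := maxn N d.+1; pose g r := c r * ('C(d, r))%:R.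
  have -> : c d = g d by rewrite /g binn mulr1.
  rewrite -(big_ord_recr d g).
  have wid n : (n <= M)%N -> (forall r, (n <= r)%N -> g r = 0) ->
      \sum_(r < n) g r = \sum_(r < M) g r.
    move=> nM g0; rewrite (big_ord_widen _ g nM) big_mkcond.
    by apply: eq_bigr => r _; case: ltnP => // /g0.
  rewrite (wid N) ?leq_maxl // => [|r /c0 c0r]; last by rewrite /g c0r mul0r.
  by rewrite (wid d.+1) ?leq_maxr // => r dr; rewrite /g bin_small // mulr0.
move=> e e' r; elim/ltn_ind: r => r IH.
have := key _ e r; rewrite (key _ e' r).
rewrite (eq_bigr (fun i : 'I_r => b i * ('C(r, i))%:R)).
  by move/addrI.
by move=> i _; rewrite IH.
Qed.

Definition fdiff (f : nat -> rat) (n : nat) : rat := f n.+1 - f n.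

Fixpoint polyfun_deg (N : nat) (f : nat -> rat) : Prop :=
  if N is N'.+1 then polyfun_deg N' (fdiff f) else forall n, f n = 0.

Definition polyfun (f : nat -> rat) := exists N, polyfun_deg N f.

Lemma polyfun_deg_ext N f g : f =1 g -> polyfun_deg N f -> polyfun_deg N g.
Proof.
elim: N f g => [|N IH] f g fg /=; first by move=> f0 n; rewrite -fg.
by apply: IH => n; rewrite /fdiff !fg.
Qed.

Lemma polyfun_ext f g : f =1 g -> polyfun f -> polyfun g.
Proof. by move=> fg [N fN]; exists N; apply: polyfun_deg_ext fg fN. Qed.

Lemma polyfun_deg0 N f : (forall n, f n = 0) -> polyfun_deg N f.
Proof.
by elim: N f => //= N IH f f0; apply: IH => n; rewrite /fdiff !f0 subr0.
Qed.

Lemma polyfun_degW N M f : (N <= M)%N -> polyfun_deg N f -> polyfun_deg M f.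
Proof.
elim: N M f => [|N IH] [|M] f //= NM; last exact: IH.
by move=> f0; apply: (@polyfun_deg0 M.+1).
Qed.

Lemma polyfun_degD N f g :
  polyfun_deg N f -> polyfun_deg N g -> polyfun_deg N (fun n => f n + g n).
Proof.
elim: N f g => [|N IH] f g /=; first by move=> f0 g0 n; rewrite f0 g0 addr0.
move=> fN gN; apply: polyfun_deg_ext (IH _ _ fN gN) => n.
by rewrite /fdiff; ring.
Qed.

Lemma polyfunD f g : polyfun f -> polyfun g -> polyfun (fun n => f n + g n).
Proof.
move=> [N fN] [M gM]; exists (maxn N M); apply: polyfun_degD.
  exact: polyfun_degW (leq_maxl _ _) fN.
exact: polyfun_degW (leq_maxr _ _) gM.
Qed.

Lemma polyfun_degS N f : polyfun_deg N f -> polyfun_deg N (fun n => f n.+1).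
Proof. by elim: N f => [|N IH] f //=; apply: IH. Qed.

Lemma polyfunS f : polyfun f -> polyfun (fun n => f n.+1).
Proof. by case=> N fN; exists N; apply: polyfun_degS. Qed.

Lemma polyfun_diff f : polyfun (fdiff f) -> polyfun f.
Proof. by case=> N fN; exists N.+1. Qed.

Lemma polyfunM f g : polyfun f -> polyfun g -> polyfun (fun n => f n * g n).
Proof.
move=> [N fN] [M gM]; have [S leS] := ubnP (N + M).
elim: S N M f g fN gM leS => // S IH N M f g.
case: N => [|N] fN.
  by move=> _ _; exists 0%N => n; rewrite fN mul0r.
case: M => [|M] gM.
  by move=> _; exists 0%N => n; rewrite gM mulr0.
move=> leS; apply: polyfun_diff.
apply: (@polyfun_ext (fun n => f n.+1 * fdiff g n + fdiff f n * g n)).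
  by move=> n; rewrite /fdiff; ring.
apply: polyfunD.
  by apply: (IH N.+1 M (fun n => f n.+1)) => //; [exact: polyfun_degS|lia].
by apply: (IH N M.+1) => //; lia.
Qed.

Lemma polyfunC c : polyfun (fun=> c).
Proof. by exists 1%N => n; rewrite /fdiff subrr. Qed.

Lemma polyfun_nat : polyfun (fun n => n%:R).
Proof. by exists 2%N => n; rewrite /fdiff -!natr1; ring. Qed.

Lemma polyfun_expansion (f : nat -> int) :
  polyfun (fun d => (f d)%:~R) -> exists b, binomial_expansion f b.
Proof.
pose h d : rat := (f d)%:~R; rewrite -/h /binomial_expansion -/(h _).
move=> [N hN]; suff [b [b0 hb]] : exists b : nat -> rat,
    (forall r, (N <= r)%N -> b r = 0) /\
    forall d, h d = \sum_(r < N) b r * ('C(d, r))%:R.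
  by exists b, N.
move: h hN => {}h; elim: N h => [|N IH] h /=.
  by move=> h0; exists (fun=> 0); split=> // d; rewrite big_ord0.
move=> /IH[b [b0 hb]].
exists (fun r => if r is r'.+1 then b r' else h 0%N); split=> [[|r] // /b0 //|].
elim=> [|d IHd].
  rewrite big_ord_recl /= bin0 mulr1 big1 ?addr0 // => i _.
  by rewrite bin_small // mulr0.
have -> : h d.+1 = h d + fdiff h d by rewrite /fdiff addrC subrK.
rewrite IHd hb !big_ord_recl /= !bin0 -addrA -big_split /=.
congr (_ + _); apply: eq_bigr => i _.
by rewrite /bump /= !add1n binS natrD mulrDr.
Qed.

(* Finite sums of products u(n) v(d) of polynomial functions. *)
Inductive polyfun2 : (nat -> nat -> rat) -> Prop :=
| Polyfun2_tensor u v :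
    polyfun u -> polyfun v -> polyfun2 (fun n d => u n * v d)
| Polyfun2_add f g :
    polyfun2 f -> polyfun2 g -> polyfun2 (fun n d => f n d + g n d)
| Polyfun2_ext f g : f =2 g -> polyfun2 f -> polyfun2 g.

Lemma polyfun2_mul u v f : polyfun u -> polyfun v -> polyfun2 f ->
  polyfun2 (fun n d => u n * v d * f n d).
Proof.
move=> pu pv; elim=> {f} [u' v' pu' pv'|f g _ pf _ pg|f g fg _ pf].
- apply: (@Polyfun2_ext (fun n d => (u n * u' n) * (v d * v' d))).
    by move=> n d /=; ring.
  by apply: Polyfun2_tensor; apply: polyfunM.
- apply: Polyfun2_ext (Polyfun2_add pf pg) => n d /=; ring.
- by apply: Polyfun2_ext pf => n d; rewrite fg.
Qed.

Lemma polyfun2_sum f : polyfun2 f ->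
  polyfun2 (fun n d => \sum_(i < n) f i d).
Proof.
elim=> {f} [u v pu pv|f g _ pf _ pg|f g fg _ pf].
- apply: (@Polyfun2_ext (fun n d => (\sum_(i < n) u i) * v d)).
    by move=> n d; rewrite big_distrl.
  apply: Polyfun2_tensor => //; apply: polyfun_diff.
  by apply: polyfun_ext pu => n; rewrite /fdiff big_ord_recr /=; ring.
- by apply: Polyfun2_ext (Polyfun2_add pf pg) => n d; rewrite big_split.
- by apply: Polyfun2_ext pf => n d; apply: eq_bigr.
Qed.

Lemma polyfun2_diag f : polyfun2 f -> polyfun (fun d => f d.+1 d).
Proof.
elim=> {f} [u v pu pv|f g _ pf _ pg|f g fg _ pf].
- by apply: polyfunM => //; apply: polyfunS.
- exact: polyfunD.
- by apply: polyfun_ext pf => d; rewrite fg.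
Qed.

Definition chern_part (n d : nat) : {mpoly int[2]} :=
  \prod_(i < n) (1 + i%:Z *: x1 + (d%:Z - i%:Z) *: x2).

Lemma chern_partE d : chern_part d.+1 d = chern_total d.
Proof.
apply: eq_bigr => i _; have id : (i <= d)%N by case: i.
by rewrite subzn // -!scaler_nat !natz.
Qed.

Lemma mcoeff_mulX (p : {mpoly int[2]}) k m :
  (p * 'X_[k])@_m = if (k <= m)%MM then p@_(m - k) else 0.
Proof.
case: ifP => km; first by rewrite -{1}(submK km) addmC mcoeffMX.
rewrite {1}[p]mpolyE big_distrl raddf_sum big1_seq //= => m' _.
rewrite -scalerAl -mpolyXD mcoeffZ mcoeffX; case: eqP => [e|_]; last first.
  by rewrite mulr0.
by rewrite -e lem_addl in km.
Qed.

Lemma chern_part_polyfun2 m :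
  polyfun2 (fun n d => ((chern_part n d)@_m)%:~R).
Proof.
have [D] := ubnP (mdeg m); elim: D m => // D IH m lemD.
pose g i n d : rat :=
  (if (U_(i) <= m)%MM then (chern_part n d)@_(m - U_(i)) else 0)%:~R.
have pg i : polyfun2 (g i).
  rewrite /g; case im: (U_(i) <= m)%MM; last first.
    apply: Polyfun2_ext (Polyfun2_tensor (polyfunC 0) (polyfunC 0)) => n d.
    by rewrite mul0r.
  apply: IH; have := mdegD (m - U_(i))%MM U_(i)%MM.
  by rewrite (submK im) mdeg1; lia.
pose c : rat := (m == 0%MM)%:R.
have tensorC u v := Polyfun2_tensor (polyfunC u) (polyfunC v).
apply: (@Polyfun2_ext (fun n d => c * 1 + \sum_(i < n)
   ((i%:R * 1 * g ord0 i d + 1 * d%:R * g ord_max i d)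
     + - i%:R * 1 * g ord_max i d))); last first.
  apply: Polyfun2_add; first exact: tensorC.
  have pN : polyfun (fun n => - n%:R).
    by apply: polyfun_ext (polyfunM (polyfunC (-1)) polyfun_nat) => n;
      rewrite mulN1r.
  apply: (@polyfun2_sum (fun i d => (i%:R * 1 * g ord0 i d
     + 1 * d%:R * g ord_max i d) + - i%:R * 1 * g ord_max i d)).
  apply: Polyfun2_add; first apply: Polyfun2_add.
  - exact: (polyfun2_mul polyfun_nat (polyfunC 1) (pg ord0)).
  - exact: (polyfun2_mul (polyfunC 1) polyfun_nat (pg ord_max)).
  - exact: (polyfun2_mul pN (polyfunC 1) (pg ord_max)).
move=> n d; elim: n => [|n IHn].
  by rewrite big_ord0 addr0 mulr1 /chern_part big_ord0 mcoeff1 /c; case: eqP.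
rewrite big_ord_recr /= addrA IHn /chern_part big_ord_recr /= -/(chern_part n d).
rewrite !mulrDr !mulr1 !mcoeffD -!scalerAr !mcoeffZ !mcoeff_mulX.
rewrite !rmorphD !rmorphM rmorphB /= -!pmulrn /g.
by ring.
Qed.

Lemma binomial_expansion_exists k j (A : nat -> nat -> int) :
  (j <= k./2)%N -> (forall d, schur_expansion k d (A^~ d)) ->
  exists b, binomial_expansion (A j) b.
Proof.
move=> jk hA; apply: polyfun_expansion.
have pf m : polyfun (fun d => ((chern_total d)@_m)%:~R).
  apply: polyfun_ext (polyfun2_diag (chern_part_polyfun2 m)) => d /=.
  by rewrite chern_partE.
have AE d i : (i <= k./2)%N ->
    \sum_(i0 < i.+1) A i0 d = (chern_total d)@_(mon (k - i) i).
  by move/schur_expansionP: (hA d); apply.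
case: j jk => [|j] jk.
  by apply: polyfun_ext (pf (mon (k - 0) 0)) => d; rewrite -AE // big_ord1.
apply: (@polyfun_ext (fun d => ((chern_total d)@_(mon (k - j.+1) j.+1))%:~R
   + -1 * ((chern_total d)@_(mon (k - j) j))%:~R)); last first.
  by apply: polyfunD => //; apply: polyfunM => //; apply: polyfunC.
move=> d /=; rewrite -!AE ?(ltnW jk) // big_ord_recr /= rmorphD /=.
by ring.
Qed.

(* Main.v *)
Require Import Defs.
From mathcomp Require Import all_boot all_order all_algebra.
From mathcomp Require Import mpoly ring zify.

Set Implicit Arguments.
Unset Strict Implicit.
Unset Printing Implicit Defensive.

Import Order.TTheory GRing.Theory Num.Theory.
Local Open Scope ring_scope.

(* Put u_i = 1 + i x1, D = 1 + d x1 and x2 = t x1.  Then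
   1 + i x1 + (d - i) x2 = u_i (1 - t) + D t, so the coefficients of x2^1 and x2^2
   of the product are combinations of elementary symmetric polynomials of the
   u_i.  With E_k = e_k(0,...,d) this gives
     2 A_{k,2} = k (k + 1) E_k - 2 k d (d + 2 - k) E_{k-1}
                 + d^2 (d + 3 - k) (d + 2 - k) E_{k-2}.
   Let e(k,m) be the binomial coefficients of E_k; they satisfy
   e(k,m) = m e(k-1,m-1) + (m-1) e(k-1,m-2).  Expressed through e(k-2,_), the
   coefficient 2 B_{k,2,m} is a linear form in e(k-2,m), ..., e(k-2,m-4) whose
   negative weights sit at the lower indices, and it is nonnegative because
   (m + 1 - q) e(q,m+1) >= (2 q - m) e(q,m), which follows by induction from
   the recurrence. *)

(** * Coefficients of x2 and x2^2 in the partial products *)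

Lemma mcoeff_mul_x1 (p : {mpoly int[2]}) j a :
  (p * x1)@_(mon j a) = if j is j'.+1 then p@_(mon j' a) else 0.
Proof.
rewrite mcoeff_mulX lep1mP mon0; case: j => [|j] //=; congr (_@_ _).
by rewrite [LHS]monE !mnmBE mon0 mon1 !mnm1E /= subSS !subn0.
Qed.

Lemma mcoeff_mul_x2 (p : {mpoly int[2]}) j a :
  (p * x2)@_(mon j a) = if a is a'.+1 then p@_(mon j a') else 0.
Proof.
rewrite mcoeff_mulX lep1mP mon1; case: a => [|a] //=; congr (_@_ _).
by rewrite [LHS]monE !mnmBE mon0 mon1 !mnm1E /= subSS !subn0.
Qed.

Definition chern_coef (n d j a : nat) : int := (chern_part n d)@_(mon j a).

Lemma chern_coef0 d j a :
  chern_coef 0 d j a = ((j == 0%N) && (a == 0%N))%:R.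
Proof.
rewrite /chern_coef /chern_part big_ord0 mcoeff1.
have -> : (0%MM : 'X_{1..2}) = mon 0 0 by rewrite [LHS]monE !mnm0E.
by rewrite mon_eq.
Qed.

Lemma chern_coefS n d j a :
  chern_coef n.+1 d j a = chern_coef n d j a
    + n%:Z * (if j is j'.+1 then chern_coef n d j' a else 0)
    + (d%:Z - n%:Z) * (if a is a'.+1 then chern_coef n d j a' else 0).
Proof.
rewrite /chern_coef /chern_part big_ord_recr /= -/(chern_part n d).
rewrite !mulrDr mulr1 !mcoeffD -!scalerAr !mcoeffZ.
by rewrite mcoeff_mul_x1 mcoeff_mul_x2.
Qed.

(** The factor i supplying x2 contributes (d - i) e_j of the other numbers; each j-subset misses n -
    j indices, and the weight i produces each (j+1)-subset j + 1 times. *)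
Lemma chern_coef1E n d j :
  chern_coef n d j 1 =
    d%:Z * (n%:Z - j%:Z) * chern_coef n d j 0 - j.+1%:Z * chern_coef n d j.+1 0.
Proof.
elim: n j => [|n IH] j.
  by rewrite !chern_coef0; case: j => [|j] /=; rewrite ?andbF /=; ring.
rewrite !chern_coefS IH; case: j => [|j]; rewrite ?IH !intS.
  move: (chern_coef n d _ _) (chern_coef n d _ _) n%:Z d%:Z => u v x y.
  ring.
move: (chern_coef n d _ _) (chern_coef n d _ _) (chern_coef n d _ _).
move: j%:Z n%:Z d%:Z => z x y u v w.
ring.
Qed.

(** The same count over ordered pairs of factors supplying x2^2, whence the 2 on the left. *)
Lemma chern_coef2E n d j :
  2 * chern_coef n d j 2 =
    d%:Z ^+ 2 * (n%:Z - j%:Z) * (n%:Z - j%:Z - 1) * chern_coef n d j 0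
    - 2 * d%:Z * (n%:Z - j%:Z - 1) * j.+1%:Z * chern_coef n d j.+1 0
    + j.+1%:Z * j.+2%:Z * chern_coef n d j.+2 0.
Proof.
elim: n j => [|n IH] j.
  by rewrite !chern_coef0; case: j => [|j] /=; rewrite ?andbF /=; ring.
rewrite !chern_coefS !mulrDr IH chern_coef1E.
case: j => [|j]; last rewrite [2 * (n%:Z * _)]mulrCA IH.
  rewrite !intS.
  move: (chern_coef n d _ _) (chern_coef n d _ _) (chern_coef n d _ _).
  move: n%:Z d%:Z => x y u v w.
  ring.
rewrite !intS.
move: (chern_coef n d _ _) (chern_coef n d _ _) (chern_coef n d _ _).
move: (chern_coef n d _ _) j%:Z n%:Z d%:Z => t z x y u v w.
ring.
Qed.

(** * Elementary symmetric polynomials and the Schur coefficient *)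

(* The elementary symmetric polynomial e_k(0,1,...,d). *)
Definition elem_sym (k d : nat) : int := chern_coef d.+1 d k 0.

(** [d] enters only the weights of x2. This matters because [elem_sym] ties [d] to the number of
    factors. *)
Lemma chern_coef_indep n d d' j : chern_coef n d j 0 = chern_coef n d' j 0.
Proof.
elim: n j => [|n IH] j; first by rewrite !chern_coef0.
by rewrite !chern_coefS !mulr0 !addr0 (IH j); case: j => // j; rewrite (IH j).
Qed.

Lemma elem_symS0 k : elem_sym k.+1 0 = 0.
Proof.
by rewrite /elem_sym chern_coefS !chern_coef0 /= !(mul0r, mulr0, addr0).
Qed.

Lemma elem_sym0 d : elem_sym 0 d = 1.
Proof.
rewrite /elem_sym; elim: d.+1 => [|n IH]; first by rewrite chern_coef0.
by rewrite chern_coefS !mulr0 !addr0.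
Qed.

Lemma elem_symS k d :
  elem_sym k.+1 d.+1 = elem_sym k.+1 d + d.+1%:Z * elem_sym k d.
Proof.
rewrite /elem_sym chern_coefS mulr0 addr0.
by rewrite !(chern_coef_indep d.+1 d.+1 d).
Qed.

(** By [schur_expansionP], [a 2] is the coefficient of x1^(k-2) x2^2 minus that of x1^(k-1) x2.
    Products are nested so that each linear factor becomes one [mul_index]. *)
Lemma schur_coef2 k d (a : nat -> int) : (4 <= k)%N -> schur_expansion k d a ->
  2 * a 2%N = k%:Z * k.+1%:Z * elem_sym k d
    - 2 * k%:Z * (d%:Z * ((d%:Z + (2 - k%:Z)) * elem_sym k.-1 d))
    + d%:Z * (d%:Z * ((d%:Z + (3 - k%:Z)) * ((d%:Z + (2 - k%:Z))
        * elem_sym k.-2 d))).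
Proof.
move=> k4 /schur_expansionP e.
have e1 := e 1%N ltac:(lia); have e2 := e 2%N ltac:(lia).
rewrite big_ord_recr /= {}e1 -chern_partE in e2.
have {e2} -> : a 2%N = chern_coef d.+1 d (k - 2) 2 - chern_coef d.+1 d (k - 1) 1.
  by rewrite /chern_coef -e2 [RHS]addrC addKr.
case: k k4 e => [|[|k]] // k4 _.
rewrite subn2 subn1 mulrBr chern_coef2E chern_coef1E /elem_sym /= !intS.
move: (chern_coef _ d _ _) (chern_coef _ d _ _) (chern_coef _ d _ _) => u v w.
move: k%:Z d%:Z => x y.
ring.
Qed.

(** * Newton expansions in the binomial basis *)

(** Stopping at m = d loses nothing, as C(d, m) vanishes beyond, and avoids a degree bound. *)
Definition newton_form (f v : nat -> int) : Prop :=
  forall d, f d = \sum_(m < d.+1) v m * ('C(d, m))%:Z.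

Lemma newton_form_lin a b f g u v : newton_form f u -> newton_form g v ->
  newton_form (fun d => a * f d + b * g d) (fun m => a * u m + b * v m).
Proof.
move=> fu gv d; rewrite fu gv !mulr_sumr -big_split /=.
by apply: eq_bigr => i _; ring.
Qed.

(* Multiplication by d + c, read on the coefficients in the basis 'C(d, m). *)
Definition mul_index (c : int) (v : nat -> int) (m : nat) : int :=
  (m%:Z + c) * v m + m%:Z * v m.-1.

(** (d + c) C(d, m) = (m + c) C(d, m) + (m + 1) C(d, m + 1). *)
Lemma newton_form_mul_index c f v : newton_form f v ->
  newton_form (fun d => (d%:Z + c) * f d) (mul_index c v).
Proof.
move=> fv d; rewrite fv mulr_sumr.
rewrite (eq_bigr (fun m : 'I_d.+1 => (m%:Z + c) * v m * ('C(d, m))%:Z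
    + (d%:Z - m%:Z) * v m * ('C(d, m))%:Z)); last by move=> m _; ring.
rewrite big_split [X in _ + X = _]big_ord_recr /= subrr !mul0r addr0.
rewrite [RHS](eq_bigr (fun m : 'I_d.+1 => (m%:Z + c) * v m * ('C(d, m))%:Z
    + m%:Z * v m.-1 * ('C(d, m))%:Z)); last first.
  by move=> m _; rewrite /mul_index mulrDl.
rewrite [RHS]big_split [X in _ = _ + X]big_ord_recl /= !mul0r add0r.
congr (_ + _); apply: eq_bigr => m _.
rewrite /bump /= add1n mulrAC [RHS]mulrAC; congr (_ * _).
have md : (m <= d)%N by apply: ltnW.
by rewrite subzn // -!PoszM mul_bin_left.
Qed.

(** By Pascal's rule, summation shifts the coefficients by one. *)
Lemma newton_form_sum f g v : f 0%N = 0 ->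
  (forall d, f d.+1 = f d + g d) -> newton_form g v ->
  newton_form f (fun m => if m is m'.+1 then v m' else 0).
Proof.
move=> f0 fS gv; elim=> [|d IH]; first by rewrite big_ord1 f0 mul0r.
rewrite fS IH gv [X in X + _]big_ord_recl [RHS]big_ord_recl /= !mul0r !add0r.
rewrite [X in X + _](_ : _ = \sum_(m < d.+1) v m * ('C(d, m.+1))%:Z).
  rewrite -big_split; apply: eq_bigr => m _ /=.
  by rewrite /bump /= !add1n binS PoszD; ring.
by rewrite big_ord_recr /= bin_small // mulr0 addr0.
Qed.

(** Evaluation at d = r is a triangular system with unit diagonal. *)
Lemma newton_form_unique f v b : newton_form f v -> binomial_expansion f b ->
  forall r, b r = (v r)%:~R.
Proof.
move=> fv [N [b0 fb]] r.
have {b0}fb d : (f d)%:~R = \sum_(m < d.+1) b m * ('C(d, m))%:R.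
  rewrite fb; pose g m := b m * ('C(d, m))%:R; pose M := maxn N d.+1.
  have wid n : (n <= M)%N -> (forall m, (n <= m)%N -> g m = 0) ->
      \sum_(m < n) g m = \sum_(m < M) g m.
    move=> nM g0; rewrite (big_ord_widen _ g nM) big_mkcond.
    by apply: eq_bigr => m _; case: ltnP => // /g0.
  rewrite (wid N) ?leq_maxl // => [|m /b0 bm0]; last by rewrite /g bm0 mul0r.
  by rewrite (wid d.+1) ?leq_maxr // => m dm; rewrite /g bin_small // mulr0.
elim/ltn_ind: r => r IH.
have := fb r; rewrite fv rmorph_sum !big_ord_recr /= binn !mulr1.
rewrite (eq_bigr (fun m : 'I_r => b m * ('C(r, m))%:R)); first by move/addrI.
by move=> m _; rewrite rmorphM /= IH.
Qed.

(** * The numbers e(k, m) and their ratio bound *)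

(** Counts the permutations of {0, ..., m} with m + 1 - k cycles that fix none of 1, ..., m. *)
Fixpoint elem_sym_coef (k m : nat) : int :=
  if k is k'.+1 then
    if m is m'.+1 then mul_index 1 (elem_sym_coef k') m' else 0
  else (m == 0%N)%:R.

Lemma newton_form_elem_sym k : newton_form (elem_sym k) (elem_sym_coef k).
Proof.
elim: k => [|k IH].
  by move=> d; rewrite elem_sym0 big_ord_recl bin0 mulr1 big1 ?addr0 //.
apply: (newton_form_sum (elem_symS0 k) _ (newton_form_mul_index 1 IH)) => d.
by rewrite elem_symS intS [1 + _]addrC.
Qed.

Lemma elem_sym_coefSS k m : elem_sym_coef k.+1 m.+1 =
  (m%:Z + 1) * elem_sym_coef k m + m%:Z * elem_sym_coef k m.-1.
Proof. by []. Qed.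

Lemma elem_sym_coef_ge0 k m : 0 <= elem_sym_coef k m.
Proof.
elim: k m => [|k IH] [|m] //; rewrite elem_sym_coefSS.
by rewrite addr_ge0 ?mulr_ge0.
Qed.

Lemma elem_sym_coef_small k m : (m < k)%N -> elem_sym_coef k m = 0.
Proof.
elim: k m => [|k IH] [|m] // mk; rewrite elem_sym_coefSS !IH ?mulr0 ?addr0 //.
by apply: leq_ltn_trans (leq_pred m) _.
Qed.

Lemma elem_sym_coef_ratio k m :
  (2 * k%:Z - m%:Z) * elem_sym_coef k m
    <= (m%:Z + 1 - k%:Z) * elem_sym_coef k m.+1.
Proof.
elim: k m => [|k IH] m; first by case: m => [|m] /=; rewrite ?mulr0.
case: m => [|m].
  rewrite [elem_sym_coef k.+1 0]/= mulr0 elem_sym_coefSS mul0r addr0.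
  case: k {IH} => [|k]; first by [].
  by rewrite elem_sym_coef_small // !mulr0.
(* The hypotheses at m - 1 and m get the weights m and m + 2 of the recurrence; the slack left is
   exactly k e(k, m). *)
have IH0 : m%:Z * ((2 * k%:Z - m%:Z + 1) * elem_sym_coef k m.-1)
    <= m%:Z * ((m%:Z - k%:Z) * elem_sym_coef k m).
  case: m => [|m]; first by rewrite !mul0r.
  rewrite ler_wpM2l //; have := IH m; rewrite intS /=.
  move: (elem_sym_coef k m) (elem_sym_coef k m.+1) => u v; lia.
have IH1 := ler_wpM2l (ltac:(lia) : 0 <= m%:Z + 2) (IH m).
have q0 := mulr_ge0 (ltac:(lia) : 0 <= k%:Z) (elem_sym_coef_ge0 k m).
rewrite !elem_sym_coefSS !intS /=.
move: (elem_sym_coef k m.-1) (elem_sym_coef k m) (elem_sym_coef k m.+1) IH0 IH1 q0.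
by move=> u v w; nia.
Qed.

(** * Nonnegativity of the window form *)

(* Twice the coefficient of 'C(d, m) in A_{k,2}(d), where s = m - k and
   e_i = e(k - 2, m - i). *)
Definition window_form (m s e0 e1 e2 e3 e4 : int) : int :=
  m ^+ 2 * (s + 2) * (s + 3) * e0
  + m * (s + 2) * ((4 * s + 2) * m - (s + 1)) * e1
  + m * (m - 1) * ((6 * s - 2) * (s + 1) - m) * e2
  + (m - 2) * (m * (4 * s ^+ 2 - 2 * s - 2 * m) - s * (s - 1)) * e3
  + (m - 1) * (m - 3) * (s ^+ 2 - s - m) * e4.

(** The terms -m^2 (m-1) e2, -2 m^2 (m-2) e3 and -m (m-1)(m-3) e4 are paid for by the last three
    bounds, with multipliers m (m-1), 2 m (m-2) and (m-1)(m-3); small s needs adjusted bounds. *)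
Lemma window_form_ge0 (m s e0 e1 e2 e3 e4 : int) :
  0 <= e0 -> 0 <= e1 -> 0 <= e2 -> 0 <= e3 -> 0 <= e4 ->
  -1 <= s -> 4 <= m - s ->
  (s <= 1 -> e4 = 0) -> (s <= 0 -> e3 = 0) -> (s <= -1 -> e2 = 0) ->
  (m - 2 * s - 3) * e1 <= (s + 2) * e0 ->
  (m - 2 * s - 2) * e2 <= (s + 1) * e1 ->
  (m - 2 * s - 1) * e3 <= s * e2 ->
  (m - 2 * s) * e4 <= (s - 1) * e3 ->
  0 <= window_form m s e0 e1 e2 e3 e4.
Proof.
rewrite /window_form => p0 p1 p2 p3 p4 s1 ms z4 z3 z2 h1.
rewrite -subr_ge0 => h2; rewrite -subr_ge0 => h3; rewrite -subr_ge0 => h4.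
have m0 : 0 <= m by lia.
have m1 : 0 <= m - 1 by lia.
(* Absorbing e4 leaves it the factor s (s - 3), nonnegative for s >= 3. *)
have [s3|s3] := leP 3 s.
  have m2 : 0 <= m - 2 by lia.
  have m3 : 0 <= m - 3 by lia.
  have m6 : 0 <= m - 6 by lia.
  have q0 : 0 <= m ^+ 2 * (s + 2) * (s + 3) * e0 by rewrite !mulr_ge0 //; lia.
  have q1 : 0 <= m * (m * (4 * s ^+ 2 + 9 * s + 3) - (s + 1) ^+ 2) * e1.
    by rewrite !mulr_ge0 //; nia.
  have q2 : 0 <= m * ((m - 1) * (6 * s - 4) * (s + 1) - 2 * (m - 2) * s) * e2.
    by rewrite !mulr_ge0 //; nia.
  have q3 : 0 <= ((m - 2) * (m * (4 * s ^+ 2 - 6 * s - 2) - s * (s - 1))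
      - (m - 1) * (m - 3) * (s - 1)) * e3.
    by rewrite mulr_ge0 // subr_ge0; nia.
  have q4 : 0 <= (m - 1) * (m - 3) * s * (s - 3) * e4.
    by rewrite !mulr_ge0 //; lia.
  have r2 := mulr_ge0 (mulr_ge0 m0 m1) h2.
  have r3 := mulr_ge0 (mulr_ge0 (ltac:(lia) : 0 <= 2 * m) m2) h3.
  have r4 := mulr_ge0 (mulr_ge0 m1 m3) h4.
  have := addr_ge0 (addr_ge0 (addr_ge0 (addr_ge0 q0 q1) (addr_ge0 q2 q3))
    (addr_ge0 q4 r2)) (addr_ge0 r3 r4).
  by congr (0 <= _); ring.
have : [|| s == -1, s == 0, s == 1 | s == 2] by lia.
case/or4P => /eqP ss; subst s.
(* The form is 2 m^2 (e0 - e1) here. *)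
- by rewrite z2 // z3 // z4 //; nia.
- rewrite z3 // z4 //.
  (* From [h2], as m + 2 <= 3 (m - 2) for m >= 4. *)
  have r2 : 0 <= 3 * e1 - (m + 2) * e2 by nia.
  have := addr_ge0 (mulr_ge0 (mulr_ge0 m0 m1) r2) (addr_ge0
    (mulr_ge0 (ltac:(nia) : 0 <= 6 * m ^+ 2) p0)
    (mulr_ge0 (ltac:(nia) : 0 <= m * (m + 1)) p1)).
  by congr (0 <= _); ring.
- rewrite z4 //.
  (* The factor 8 - m in the weight of e2 splits as 3 - (m - 5); m >= 5 gives 2 (m - 2) <= 3 (m -
     3). *)
  have r3 : 0 <= 3 * e2 - 2 * (m - 2) * e3 by nia.
  have r2 : 0 <= 2 * e1 - (m - 5) * e2 by nia.
  have := addr_ge0 (addr_ge0 (mulr_ge0 (mulr_ge0 m0 m1) r2)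
    (mulr_ge0 (mulr_ge0 m0 m1) r3)) (addr_ge0
    (mulr_ge0 (ltac:(nia) : 0 <= 12 * m ^+ 2) p0)
    (mulr_ge0 (ltac:(nia) : 0 <= 16 * m ^+ 2 - 4 * m) p1)).
  by congr (0 <= _); ring.
- have m2 : 0 <= m - 2 by lia.
  have m3 : 0 <= m - 3 by lia.
  (* The weight of e4 has the factor -(m - 2); m >= 6 gives m - 2 <= 2 (m - 4). *)
  have b4 : 0 <= 2 * e3 - (m - 2) * e4 by nia.
  have q0 := mulr_ge0 (ltac:(nia) : 0 <= 20 * m ^+ 2) p0.
  have q1 := mulr_ge0 (ltac:(nia) : 0 <= 37 * m ^+ 2 - 9 * m) p1.
  have q2 := mulr_ge0
    (ltac:(nia) : 0 <= 24 * m * (m - 1) - 4 * m * (m - 2)) p2.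
  have q3 := mulr_ge0 (ltac:(lia) : 0 <= 2 * (m - 1)) p3.
  have r2 := mulr_ge0 (mulr_ge0 m0 m1) h2.
  have r3 := mulr_ge0 (mulr_ge0 (ltac:(lia) : 0 <= 2 * m) m2) h3.
  have r4 := mulr_ge0 (mulr_ge0 m1 m3) b4.
  have := addr_ge0 (addr_ge0 (addr_ge0 q0 q1) (addr_ge0 q2 q3))
    (addr_ge0 r2 (addr_ge0 r3 r4)).
  by congr (0 <= _); ring.
Qed.

(** * Binomial coefficients of 2 A_{k,2} and conclusion *)

(** Mirrors the right-hand side of [schur_coef2]. *)
Definition newton_coef2 (k m : nat) : int :=
  k%:Z * k.+1%:Z * elem_sym_coef k m
  + - (2 * k%:Z) * mul_index 0 (mul_index (2 - k%:Z) (elem_sym_coef k.-1)) m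
  + mul_index 0 (mul_index 0 (mul_index (3 - k%:Z) (mul_index (2 - k%:Z)
      (elem_sym_coef k.-2)))) m.

(* At [m = 0] the last argument is a junk value, with weight 0. *)
Lemma newton_coef2_window q m :
  newton_coef2 q.+2 m.+3 =
    window_form m.+3%:Z (m.+3%:Z - q.+2%:Z) (elem_sym_coef q m.+3)
      (elem_sym_coef q m.+2) (elem_sym_coef q m.+1) (elem_sym_coef q m)
      (elem_sym_coef q m.-1).
Proof.
rewrite /window_form /newton_coef2 /mul_index /= /mul_index /= !intS.
move: (elem_sym_coef q m.+3) (elem_sym_coef q m.+2) (elem_sym_coef q m.+1).
case: m => [|m] /=.
  move: (elem_sym_coef q 0) q%:Z => u v w x y.
  ring.
rewrite !intS.
move: (elem_sym_coef q m.+1) (elem_sym_coef q m) q%:Z m%:Z => t u v w x y z.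
ring.
Qed.

(** All terms vanish for m <= k - 2; beyond, s >= -1 and the window bound applies. *)
Lemma newton_coef2_ge0 k m : (4 <= k)%N -> 0 <= newton_coef2 k m.
Proof.
case: k => [|[|q]] // k4; have [mq|qm] := leqP m q.
  have mul0 c v j : (forall i, (i <= j)%N -> v i = 0) ->
      forall i, (i <= j)%N -> mul_index c v i = 0.
    move=> v0 i ij; rewrite /mul_index !v0 ?mulr0 ?addr0 //.
    exact: leq_trans (leq_pred i) ij.
  have small p i : (i <= q)%N -> (q < p)%N -> elem_sym_coef p i = 0.
    by move=> iq qp; rewrite elem_sym_coef_small //; apply: leq_ltn_trans qp.
  rewrite /newton_coef2 small ?(leq_trans mq) // mulr0 add0r.
  rewrite (mul0 _ _ q) ?mulr0 ?add0r //; last first.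
    by apply: mul0 => i iq; rewrite small.
  rewrite (mul0 _ _ q) //; apply: (mul0 _ _ q); apply: (mul0 _ _ q) => i iq.
  rewrite /mul_index; have [iq'|qi] := ltnP i q.
    rewrite !elem_sym_coef_small ?mulr0 //.
    exact: leq_ltn_trans (leq_pred i) iq'.
  (* At i = q = k - 2 the factor d + 2 - k has weight 0, which kills e(q, q). *)
  have -> : i = q by apply/eqP; rewrite eqn_leq iq.
  have -> : q%:Z + (2 - q.+2%:Z) = 0 by lia.
  by rewrite mul0r add0r; case: (q) k4 => // p _; rewrite elem_sym_coef_small ?mulr0.
case: m qm => [|[|[|m]]] qm; try by lia.
rewrite newton_coef2_window.
apply: window_form_ge0; rewrite ?elem_sym_coef_ge0 //; try lia.
- move=> s1; case: m qm s1 => [|m] qm s1; apply: elem_sym_coef_small => /=; lia.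
- by move=> s0; apply: elem_sym_coef_small; lia.
- by move=> s0; apply: elem_sym_coef_small; lia.
- have := elem_sym_coef_ratio q m.+2; congr (_ * _ <= _ * _); lia.
- have := elem_sym_coef_ratio q m.+1; congr (_ * _ <= _ * _); lia.
- have := elem_sym_coef_ratio q m; congr (_ * _ <= _ * _); lia.
(* At index 3 both e3 and e4 read e(q, 0) = 0. *)
- case: m qm => [|m] qm.
    by rewrite /= !(elem_sym_coef_small (_ : (0 < q)%N)) ?mulr0; lia.
  have := elem_sym_coef_ratio q m; congr (_ * _ <= _ * _); lia.
Qed.

Theorem theorem5p2
  (A : nat -> nat -> nat -> int) (B : nat -> nat -> nat -> rat)
  (hA : forall k d : nat, schur_expansion k d (fun j => A k j d))
  (hB : forall k j : nat, (j <= k./2)%N -> binomial_expansion (A k j) (B k j))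
  (k r : nat) (hk : (4 <= k)%N) :
  0 <= B k 2%N r.
Proof.
have newton2A : newton_form (fun d => 2 * A k 2%N d) (newton_coef2 k).
  move=> d; rewrite (schur_coef2 hk (hA k d)).
  have nE := newton_form_elem_sym.
  have := newton_form_lin 1 1
    (newton_form_lin (k%:Z * k.+1%:Z) (- (2 * k%:Z)) (nE k)
      (newton_form_mul_index 0 (newton_form_mul_index (2 - k%:Z) (nE k.-1))))
    (newton_form_mul_index 0 (newton_form_mul_index 0 (newton_form_mul_index
      (3 - k%:Z) (newton_form_mul_index (2 - k%:Z) (nE k.-2))))) d.
  rewrite !mul1r !addr0 mulNr => ->.
  by apply: eq_bigr => m _; rewrite !mul1r.
have expand2A : binomial_expansion (fun d => 2 * A k 2%N d)
    (fun i => 2 * B k 2%N i).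
  have [|N [b0 fb]] := hB k 2%N; first by lia.
  exists N; split=> [i /b0 ->|d]; first by rewrite mulr0.
  by rewrite rmorphM /= fb mulr_sumr; apply: eq_bigr => i _; rewrite mulrA.
rewrite -(@pmulr_rge0 _ 2) // (newton_form_unique newton2A expand2A).
by rewrite ler0z newton_coef2_ge0.
Qed.
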